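(* Let $\mathcal O$ denote the set of partitions into odd parts (repetitions allowed), and let $\mathcal R$ denote the set of partitions in which any two parts differ by at least 2. For every integer $n\ge 0$, $$\sum_{\pi\in\mathcal R,\ \sigma(\pi)=n}\omega(\pi)=\sum_{\pi'\in\mathcal O,\ \sigma(\pi')=n}2^{\nu_d(\pi')},$$ where $\nu_d(\pi')$ is the number of different parts of $\pi'$ and $\omega(\pi)$ is the multiplicative weight defined through the chains of $\pi$ as in the context.
   Context: For a partition $\pi$, $\sigma(\pi)$ denotes the sum of its parts. Given $\pi\in\mathcal R$, a chain $\chi$ of $\pi$ is a maximal block of parts of $\pi$ in which consecutive parts differ by exactly 2; every $\pi\in\mathcal R$ decomposes uniquely into chains, and all parts of a chain have the same parity. For a chain $\chi$, $\ell(\chi)$ denotes its number of parts and $\lambda(\chi)$ its least part. The weight of a chain $\chi$ with $\ell(\chi)=\ell$ is $$\omega(\chi)=\begin{cases}2,&\text{if }\chi\text{ has even parts},\\ 2\ell,&\text{if }\lambda(\chi)=1,\\ 4\ell,&\text{if }\chi\text{ has odd parts and }\lambda(\chi)>1,\end{cases}$$ and $\omega(\pi)=\prod_{\chi}\omega(\chi)$, the product over all chains $\chi$ of $\pi$ (the empty product is 1). *)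

(* Defs.v *)
From mathcomp Require Import all_boot.

Set Implicit Arguments.
Unset Strict Implicit.
Unset Printing Implicit Defensive.

(* A partition is the weakly decreasing sequence of its (positive) parts. *)
Definition is_partition (s : seq nat) : bool := sorted geq s && (0 \notin s).

(* A partition of n has at most n parts, each at most n, which makes the set of
   partitions of n finite; mem_partitions shows that none is missed. *)
Definition partitions (n : nat) : seq (seq nat) :=
  [seq s <- [seq [seq val i | i <- t] | t : n.-bseq 'I_n.+1]
    | is_partition s && (sumn s == n)].

Lemma partitions_uniq n : uniq (partitions n).
Proof.
apply: filter_uniq; rewrite map_inj_uniq ?enum_uniq // => t u eq_tu.
exact/val_inj/(inj_map val_inj).
Qed.

Lemma mem_partitions n s :
  (s \in partitions n) = is_partition s && (sumn s == n).
Proof.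
rewrite mem_filter; apply: andb_idr => /andP[/andP[_ s_gt0] /eqP sum_s].
have size_s : size s <= n.
  rewrite -{n}sum_s; elim: s s_gt0 => //= x s IHs.
  rewrite inE negb_or eq_sym -lt0n => /andP[x_gt0 /IHs le_s].
  by rewrite -add1n leq_add.
have s_lt : all (fun x => x < n.+1) s.
  apply/allP=> x xs; rewrite ltnS -{n size_s}sum_s.
  by rewrite (perm_sumn (perm_to_rem xs)) leq_addr.
pose u := [seq inord x : 'I_n.+1 | x <- s].
have size_u : size u <= n by rewrite size_map.
apply/imageP; exists (Bseq size_u) => //=.
rewrite -map_comp -[LHS]map_id; apply/eq_in_map => x /(allP s_lt) x_lt /=.
by rewrite inordK.
Qed.

Definition inR (s : seq nat) : bool := pairwise (fun x y => y + 2 <= x) s.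

Definition inO (s : seq nat) : bool := all odd s.

Definition nu_d (s : seq nat) : nat := size (undup s).

Definition is_block (s c : seq nat) : bool :=
  [&& c != [::], infix c s & sorted (fun x y => x == y + 2) c].

Definition infixes (s : seq nat) : seq (seq nat) :=
  undup [seq take j (drop i s) | i <- iota 0 (size s).+1, j <- iota 0 (size s).+1].

Lemma mem_infixes s c : (c \in infixes s) = infix c s.
Proof.
rewrite mem_undup; apply/allpairsP/idP => [[[i j] /= [_ _ ->]]|].
  by apply: infix_trans (infix_drop _ _); apply: infix_take.
move=> /infixP[p [q ->]]; exists (size p, size c) => /=.
rewrite drop_size_cat // take_size_cat //.
have in_iota i m : (i \in iota 0 m.+1) = (i <= m) by rewrite mem_iota.
by rewrite !in_iota !size_cat leq_addr addnCA leq_addr.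
Qed.

(* Chains: the blocks that are maximal for inclusion; for s in R its parts are
   distinct, so chains s lists each chain exactly once. *)
Definition chains (s : seq nat) : seq (seq nat) :=
  [seq c <- infixes s
    | is_block s c
      && all (fun d => is_block s d && infix c d ==> (d == c)) (infixes s)].

Lemma chains_uniq s : uniq (chains s).
Proof. exact/filter_uniq/undup_uniq. Qed.

Lemma chainsP s c :
  reflect (is_block s c /\ (forall d, is_block s d -> infix c d -> d = c))
          (c \in chains s).
Proof.
rewrite mem_filter mem_infixes; apply: (iffP andP) => [[/andP[cs /allP cmax] _]|].
  split=> // d ds cd; have /and3P[_ d_s _] := ds.
  by have := cmax d; rewrite mem_infixes d_s ds cd => /(_ isT)/eqP.
move=> [cs cmax]; rewrite cs; split; last by case/and3P: cs.
by apply/allP=> d _; apply/implyP=> /andP[ds cd]; apply/eqP/cmax.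
Qed.

(* As parts are listed in decreasing order, the least part comes last. *)
Definition least_part (c : seq nat) : nat := last 0 c.

Definition omega_chain (c : seq nat) : nat :=
  if all (fun x => ~~ odd x) c then 2
  else if least_part c == 1 then 2 * size c
  else 4 * size c.

Definition omega (s : seq nat) : nat := \prod_(c <- chains s) omega_chain c.

(* Main.v *)
Require Import Defs.
From mathcomp Require Import all_boot all_algebra qpoly zify ring.

(** Write p = q^2 and (a)_k = (1 - a)(1 - a p)...(1 - a p^(k-1)).  Both sides
    are turned into q-series, and the q-series are shown to be equal.

    Left side.  Subtracting 1, 3, 5, ... from the parts of a partition in R, read
    from the smallest, leaves a multiset of n values v >= 0, contributes q^(n^2),
    and turns a chain of length l into a value of multiplicity l: even values
    come from odd parts and odd values from even parts.  A chain of even parts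
    thus gives the factor 1 + 2z/(1-z) = (1+z)/(1-z) at z -> z q^v, and a chain
    of odd parts gives 1 + 4z/(1-z)^2 = ((1+z)/(1-z))^2.  Hence the generating
    function of partitions in R, weighted with 4l for all odd chains, is the sum
    over n of q^(n^2) times the coefficient of z^n in a product of three functions
    E(z) = prod_i (1 + z p^i)/(1 - z p^i) = sum_k e_k z^k,
    e_k = (-1)_k/(p)_k, at the arguments z, z and qz.  For parts at least 2 one
    subtracts 2, 4, 6, ..., which gives q^(n^2+n) and the arguments z, qz and qz.
    The weight 2l of chains with least part 1 is the mean of 4l and 0, so twice
    the left side is the sum of these two triple series (odd_start at 1,
    even_start at q).

    Evaluation.  Summing over the index k of the third factor first leaves a
    double series in e_i e_j with the inner sums
    J_n = sum_k e_k q^(k^2 + k + 2nk), n = i + j, which satisfy the three-term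
    recurrence lebesgue_rec.  Grouping by m = i - j gives
    sum over all integers m of q^(m^2) D_|m|, where D_m = D_(m+1) by telescoping
    against that recurrence (diag_telescope); letting m grow, D_m = 2 (-p)_N/(p)_N
    for large N.  So the left side is (-p)_oo/(p)_oo times the theta series
    sum_m q^(m^2).  Gauss's identity sum_m (-y)^(m^2) = prod_j (1 - y^j)/(1 + y^j),
    taken at y = -q, turns this into
    prod_j (1 + q^(2j+1))/(1 - q^(2j+1)), in which 1 + 2x/(1-x) at x = q^(2j+1)
    records the multiplicity of the part 2j+1 with weight 2 if it occurs: this is
    the right side.

    Convergence is avoided by working in a commutative ring with q^N = 0, where
    all the series are finite sums; the coefficients are finally read off in
    Z[X]/(X^N) with N > n.  On the combinatorial side, partitions are built from
    the bottom: removing the run that contains the least allowed part gives one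
    recurrence (weighted_gf_rec) that covers both R (gap 2) and O (gap 0). *)

Set Implicit Arguments.
Unset Strict Implicit.
Unset Printing Implicit Defensive.
Import GRing.Theory.

(** * Gapped sequences and their runs *)

(** Gap 2 describes R; gap 0 describes arbitrary partitions, among which O is
    selected by the weight 0 on even parts. *)
Definition gapped (g : nat) (s : seq nat) : bool :=
  sorted (fun x y => y + g <= x) s.

Lemma gap_trans g : transitive (fun x y => y + g <= x).
Proof. by move=> y x z; lia. Qed.

(** The run of length [l], common difference [g] and least part [b]; for
    [g = 0], the part [b] repeated [l] times. *)
Fixpoint block (g b l : nat) : seq nat :=
  if l is l'.+1 then b + g * l' :: block g b l' else [::].

Lemma size_block g b l : size (block g b l) = l.
Proof. by elim: l => //= l ->. Qed.

Lemma last_block g b l : last 0 (block g b l.+1) = b.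
Proof.
rewrite /=; elim: l => [|l IHl] /=; first by rewrite muln0 addn0.
by rewrite IHl.
Qed.

Lemma block_ge g b l : all (leq b) (block g b l).
Proof. by elim: l => //= l ->; rewrite leq_addr. Qed.

Lemma mem_block_least g b l : b \in block g b l.+1.
Proof. by rewrite -[X in X \in _](last_block g b l) /= mem_last. Qed.

Lemma sumn_block g b l : sumn (block g b l) = b * l + g * 'C(l, 2).
Proof.
elim: l => [|l IHl] /=; first by rewrite !muln0.
by rewrite IHl binS bin1; lia.
Qed.

Lemma gapped_block g b l : gapped g (block g b l).
Proof.
case: l => //= l; elim: l => //= l IHl; rewrite IHl andbT.
by rewrite mulnS; lia.
Qed.

Lemma gapped_cat_block g b l s :
  gapped g s -> all (leq (b + g * l + 1)) s -> gapped g (s ++ block g b l).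
Proof.
case: s => [|x s] gs sge; first exact: gapped_block.
rewrite /gapped /= cat_path; apply/andP; split; first exact: gs.
have := allP sge _ (mem_last x s); case: l {sge} => // l.
by have := gapped_block g b l.+1; rewrite /gapped /= => ->; rewrite mulnS; lia.
Qed.

(** The run at the bottom of a gapped sequence is maximal, so the part before it
    exceeds [b + g * l.+1]: cutting it off leaves a gapped sequence with a larger
    lower bound, which is what makes recursion on the least part possible. *)
Lemma gapped_block_split g b s : gapped g s -> all (leq b) s -> b \in s ->
  exists s' l, [/\ s = s' ++ block g b l.+1, gapped g s'
                 & all (leq (b + g * l.+1 + 1)) s'].
Proof.
elim: s => // x s IHs gs /= /andP[bx bs].
have xs : all (fun y => y + g <= x) s.
  exact: (order_path_min (@gap_trans g)).
have {}gs' : gapped g s by apply: path_sorted gs.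
case bs_in: (b \in s); last first.
  rewrite inE bs_in orbF => /eqP eb; subst x.
  case: s => [|y s] in bs bs_in gs gs' xs {IHs} *.
    by exists [::], 0; rewrite /= muln0 addn0.
  move: bs xs bs_in => /= /andP[by_ _] /andP[yb _]; rewrite inE.
  by have -> : b == y by lia.
move=> _; have [s' [l [es gs1 sge]]] := IHs gs' bs bs_in.
case: s' => [|y s'] in es gs1 sge *.
  have xl : b + g * l + g <= x.
    by move/allP: xs => /(_ (b + g * l)); rewrite es /= inE eqxx; apply.
  case: (eqVneq x (b + g * l.+1)) => [->|neq].
    by exists [::], l.+1; rewrite es.
  exists [:: x], l; rewrite es /= andbT; split=> //.
  by move: neq xl; rewrite mulnS; lia.
exists (x :: y :: s'), l; rewrite es; split=> //.
  by move: gs; rewrite es /gapped /= cat_path => /and3P[-> ->].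
move: sge => /= /andP[yb ->]; rewrite yb !andbT.
by move: xs; rewrite es /= => /andP[yx _]; lia.
Qed.

(** Cutting wherever the difference of neighbours is not exactly [g] gives the
    chains when [g = 2], in a form that recursion on the sequence can follow. *)
Fixpoint runs (g : nat) (s : seq nat) : seq (seq nat) :=
  if s is x :: s' then
    if runs g s' is c :: cs then
      if x == head 0 c + g then (x :: c) :: cs else [:: x] :: c :: cs
    else [:: [:: x]]
  else [::].

Lemma runs_cons g x s :
  exists c cs, runs g (x :: s) = (x :: c) :: cs.
Proof.
rewrite /=; case: runs => [|c cs]; first by exists [::], [::].
by case: ifP => _; [exists c, cs | exists [::], (c :: cs)].
Qed.

Lemma flatten_runs g s : flatten (runs g s) = s.
Proof.
elim: s => //= x s; case: (runs g s) => [|c cs] /= <- //.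
by case: ifP.
Qed.

Lemma runs_block g b l : runs g (block g b l.+1) = [:: block g b l.+1].
Proof.
elim: l => //= l -> /=.
by rewrite mulnS addnCA addnC eqxx.
Qed.

(** The hypothesis forbids a merge with the last run of [s]; hence the bottom run
    can be read off from the result, and weights that are products over runs are
    multiplicative here. *)
Lemma runs_cat_block g b l s : all (leq (b + g * l.+1 + 1)) s ->
  runs g (s ++ block g b l.+1) = rcons (runs g s) (block g b l.+1).
Proof.
elim: s => [_|x s IHs /andP[xb sge]]; first exact: runs_block.
rewrite cat_cons.
have -> : runs g (x :: s ++ block g b l.+1) =
  if runs g (s ++ block g b l.+1) is c :: cs then
      if x == head 0 c + g then (x :: c) :: cs else [:: x] :: c :: cs
    else [:: [:: x]] by [].
rewrite IHs //=.
case: (runs g s) => [|c cs] //=; last by case: ifP.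
by rewrite ifN //; move: xb; rewrite mulnS; lia.
Qed.

(** Enumeration by the least part: either [b] does not occur, or it starts a run
    of length [l < N] after which the parts are at least [b + g * l + 1].  The
    fuel [k] only guarantees termination: all gapped sequences of length below [N]
    with parts from [b] to [b + k - 1] are present, and some others too. *)
Fixpoint gapped_seqs (g N k b : nat) : seq (seq nat) :=
  if k is k'.+1 then
    gapped_seqs g N k' b.+1 ++
    [seq s ++ block g b l | l <- index_iota 1 N,
                            s <- gapped_seqs g N k' (b + g * l + 1)]
  else [:: [::]].

Lemma gapped_seqs_sound g N k b s : s \in gapped_seqs g N k b ->
  gapped g s /\ all (leq b) s.
Proof.
elim: k b s => [|k IHk] b s /=; first by rewrite inE => /eqP->.
rewrite mem_cat => /orP[/IHk[gs sge]|].
  by split=> //; apply: sub_all sge => x; apply: ltnW.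
move=> /allpairsPdep[l [t [_ /IHk[gt tge] ->]]]; split.
  exact: gapped_cat_block.
rewrite all_cat block_ge andbT; apply: sub_all tge => x; lia.
Qed.

Lemma gapped_seqs_complete g N k b s : gapped g s -> size s < N ->
  all (fun x => b <= x < b + k) s -> s \in gapped_seqs g N k b.
Proof.
elim: k b s => [|k IHk] b s gs sN sb.
  case: s sb {gs sN} => //= x s /andP[]; lia.
rewrite /= mem_cat; case bs: (b \in s); last first.
  rewrite IHk //; apply/allP => x xs; have := allP sb _ xs.
  have : x != b by apply: contraFneq bs => <-.
  by lia.
have sb1 : all (leq b) s by apply: sub_all sb => x /andP[].
have [t [l [es gt tge]]] := gapped_block_split gs sb1 bs.
apply/orP; right; apply/allpairsPdep; exists l.+1, t; split => //.
  by move: sN; rewrite es size_cat size_block mem_index_iota; lia.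
apply: IHk => //; first by move: sN; rewrite es size_cat; lia.
apply/allP => x xt; have := allP tge _ xt.
by have := allP sb x; rewrite es mem_cat xt => /(_ isT); lia.
Qed.

Lemma gapped_seqs_uniq g N k b : uniq (gapped_seqs g N k b).
Proof.
elim: k b => //= k IHk b; rewrite cat_uniq IHk /=; apply/andP; split.
  apply/hasPn => s /allpairsPdep[l [t [lN _ ->]]].
  apply/negP => /gapped_seqs_sound[_ /allP/(_ b)].
  move: lN; rewrite mem_index_iota; case: l => // l _.
  by rewrite mem_cat mem_block_least orbT ltnn => /(_ isT).
apply: allpairs_uniq_dep; first exact: iota_uniq.
  by move=> l _; apply: IHk.
move=> u v /allpairsPdep[l [s [lN sge ->]]] /allpairsPdep[l' [s' [lN' sge' ->]]] /=.
move: lN lN' sge sge'; rewrite !mem_index_iota.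
case: l => // l _; case: l' => // l' _.
move=> /gapped_seqs_sound[_ sge] /gapped_seqs_sound[_ sge'] E.
have /rcons_inj Er : rcons (runs g s) (block g b l.+1) =
       rcons (runs g s') (block g b l'.+1).
  by rewrite -!runs_cat_block // E.
have Es : runs g s = runs g s' := congr1 fst Er.
have -> : s = s' by rewrite -(flatten_runs g s) Es flatten_runs.
have /(congr1 size) := congr1 snd Er.
by rewrite !size_block => -[->].
Qed.

(** * Weighted generating functions of gapped sequences *)

Lemma size_le_sumn s : 0 \notin s -> size s <= sumn s.
Proof.
elim: s => //= x s IHs; rewrite inE negb_or eq_sym -lt0n => /andP[x0 /IHs].
lia.
Qed.

(** Sequences of the enumeration with other sums are discarded by the filter, so
    any large enough bounds [N] and [k] will do. *)
Lemma sum_partitions g N k n (P : pred (seq nat)) (f : seq nat -> nat) :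
  n < N -> n <= k -> {in partitions n, P =1 gapped g} ->
  \sum_(s <- partitions n | P s) f s =
  \sum_(s <- gapped_seqs g N k 1 | sumn s == n) f s.
Proof.
move=> nN nk PE; rewrite -big_filter -[RHS]big_filter; apply: perm_big.
apply: uniq_perm => [||s].
- exact/filter_uniq/partitions_uniq.
- exact/filter_uniq/gapped_seqs_uniq.
rewrite [LHS]mem_filter [RHS]mem_filter.
case sp: (s \in partitions n).
  rewrite PE // andbT; move: sp; rewrite mem_partitions.
  move=> /andP[/andP[_ s0] sn]; rewrite sn /=.
  apply/idP/idP => [gs|/gapped_seqs_sound[]//].
  have ss := size_le_sumn s0.
  apply: gapped_seqs_complete; rewrite ?(leq_ltn_trans ss) ?(eqP sn) //.
  apply/allP => x xs; apply/andP; split.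
    by rewrite lt0n; apply: contraNneq s0 => <-.
  by move: nk; rewrite -(eqP sn) (perm_sumn (perm_to_rem xs)) /=; lia.
rewrite andbF; apply/esym/negP => /andP[sn /gapped_seqs_sound[gs s1]].
move/negP: sp; apply; rewrite mem_partitions sn andbT; apply/andP; split.
  by apply: sub_sorted gs => x y; rewrite /geq /=; lia.
by apply/negP => /(allP s1).
Qed.

Section Weights.
Variables (A : comNzRingType) (q : A) (g N : nat).
Variables (wt : seq nat -> nat) (w : nat -> nat -> nat).
Hypothesis wt_nil : wt [::] = 1.
Hypothesis wt_block : forall b l s, 0 < b -> gapped g s ->
  all (leq (b + g * l.+1 + 1)) s ->
  wt (s ++ block g b l.+1) = wt s * w b l.+1.
Local Open Scope ring_scope.

Definition weighted_gf k b : A :=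
  \sum_(s <- gapped_seqs g N k b) (wt s)%:R * q ^+ sumn s.

(** The two cases of [gapped_seqs]; the exponent is the sum of the removed run. *)
Lemma weighted_gf_rec k b : (0 < b)%N -> weighted_gf k.+1 b = weighted_gf k b.+1 +
  \sum_(1 <= l < N) (w b l)%:R * q ^+ (b * l + g * 'C(l, 2)) *
     weighted_gf k (b + g * l + 1).
Proof.
move=> b0; rewrite /weighted_gf /= big_cat; congr (_ + _).
rewrite big_allpairs_dep /=; apply: eq_big_nat => l /andP[l0 _].
rewrite mulr_sumr [LHS]big_seq_cond [RHS]big_seq_cond; apply: eq_bigr => s.
rewrite andbT => /gapped_seqs_sound[gs sge].
case: l l0 sge => // l _ sge.
rewrite wt_block // sumn_cat sumn_block natrM exprD; ring.
Qed.

(** The recurrence refers to larger lower bounds only, so a solution is determined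
    by its value 1 beyond a bound [M].  The threshold [c] leaves room for an
    exceptional weight on small parts, as the chains with least part 1 have. *)
Lemma weighted_gf_unique (c M : nat) (V : nat -> A) : (0 < c)%N ->
  (forall b, (M <= b)%N -> V b = 1) ->
  (forall b, (c <= b)%N -> V b = V b.+1 +
     \sum_(1 <= l < N) (w b l)%:R * q ^+ (b * l + g * 'C(l, 2)) *
     V (b + g * l + 1)%N) ->
  forall k b, (c <= b)%N -> (M <= b + k)%N -> weighted_gf k b = V b.
Proof.
move=> c0 V1 Vrec; elim=> [|k IHk] b cb bM.
  have bM' : (M <= b)%N by rewrite addn0 in bM.
  by rewrite V1 // /weighted_gf [gapped_seqs _ _ _ _]/= big_seq1 wt_nil mulr1.
have b0 := leq_trans c0 cb.
rewrite weighted_gf_rec // Vrec // IHk ?(leqW cb) ?addSnnS //.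
congr (_ + _); apply: eq_bigr => l _; rewrite IHk //; lia.
Qed.

End Weights.

Lemma odd_partition_block b l s : 0 < b -> gapped 0 s ->
  all (leq (b + 0 * l.+1 + 1)) s ->
  inO (s ++ block 0 b l.+1) * 2 ^ nu_d (s ++ block 0 b l.+1) =
  inO s * 2 ^ nu_d s * (if odd b then 2 else 0).
Proof.
move=> _ _ sge.
have E : block 0 b l.+1 = nseq l.+1 b.
  by elim: l.+1 => //= k ->; rewrite addn0.
have bs : b \notin s by apply/negP => /(allP sge); rewrite mul0n; lia.
have ub : undup (nseq l.+1 b) = [:: b].
  elim: l {sge E} => //= l IHl.
  by rewrite inE eqxx.
have us : [seq x <- undup s | x \notin nseq l.+1 b] = undup s.
  apply/all_filterP/allP => x; rewrite mem_undup mem_nseq => xs.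
  by apply: contra bs => /andP[_ /eqP <-].
rewrite E /inO all_cat all_nseq /nu_d undup_cat size_cat us ub addn1 expnS.
by case: (odd b); rewrite ?andbT ?andbF ?muln0 //=; lia.
Qed.

(** * Chains as runs *)

Lemma runs_neq0 g s c : c \in runs g s -> c != [::].
Proof.
elim: s c => //= x s; case: (runs g s) => [|d ds] IHs c.
  by rewrite inE => /eqP->.
case: ifP => _; rewrite inE => /predU1P[->//|cds]; last exact: IHs.
by apply: IHs; rewrite inE cds orbT.
Qed.

Lemma runs_sorted g s c : c \in runs g s -> sorted (fun x y => x == y + g) c.
Proof.
elim: s c => //= x s; have := @runs_neq0 g s.
case: (runs g s) => [|d ds] d0 IHs c.
  by rewrite inE => /eqP->.
case: ifP => xd; rewrite inE => /predU1P[->//|cds]; last exact: IHs.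
  have := IHs d (mem_head _ _); have := d0 d (mem_head _ _).
  by case: d xd {IHs d0} => //= y d -> _ ->.
by apply: IHs; rewrite inE cds orbT.
Qed.

(** A run is only cut where the difference differs from [g], so a prefix with
    constant difference [g] cannot reach beyond the first run. *)
Lemma prefix_runs g c s : prefix c s -> sorted (fun x y => x == y + g) c ->
  prefix c (head [::] (runs g s)).
Proof.
elim: s c => [|x s IHs] [|z c] //; first by move=> _ _; apply: prefix0s.
case/boolP: (c == [::]) => [/eqP-> |].
  by have [d [ds ->]] := runs_cons g x s; rewrite /= !prefix0s => /andP[->].
case: c => // y c _; case: s IHs => [|y' s] IHs; first by rewrite /= andbF.
rewrite prefix_cons => /andP[/eqP-> ycs] /= /andP[/eqP zy yc].
have := IHs (y :: c) ycs yc.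
have := runs_cons g y' s; rewrite [runs g (y' :: s)]/=.
move: ycs; rewrite prefix_cons => /andP[/eqP ey _]; subst y'.
move=> [d [ds ->]] /= h.
by rewrite zy eqxx /= eqxx.
Qed.

Lemma infix_runs g c s : c != [::] -> infix c s ->
  sorted (fun x y => x == y + g) c ->
  exists2 d, d \in runs g s & infix c d.
Proof.
move=> c0; elim: s => [|x s IHs] cs sc.
  by move: cs c0; rewrite infixs0 => ->.
move: cs; rewrite infix_consl => /orP[cs|/IHs/(_ sc)[d ds cd]].
  have := prefix_runs cs sc; have [d [ds ->]] := runs_cons g x s => /= cd.
  by exists (x :: d); [apply: mem_head | apply: prefixW].
rewrite /=; case: (runs g s) ds => // e es; case: ifP => _.
  rewrite inE => /predU1P[<-|des].
    by exists (x :: d); rewrite ?mem_head //= cd orbT.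
  by exists d; rewrite // inE des orbT.
by move=> des; exists d; rewrite // inE des orbT.
Qed.

Lemma infix_mem_runs g s c : c \in runs g s -> infix c s.
Proof.
rewrite -{2}(flatten_runs g s) => cs.
by case/splitPr: cs => r1 r2; rewrite flatten_cat /= infix_infix.
Qed.

Lemma gapped_uniq g s : 0 < g -> gapped g s -> uniq s.
Proof.
move=> g0; apply: sorted_uniq; first exact: gap_trans.
by move=> x /=; lia.
Qed.

Lemma uniq_flatten_eq (T : eqType) (ss : seq (seq T)) (c d : seq T) x :
  uniq (flatten ss) -> c \in ss -> d \in ss -> x \in c -> x \in d -> c = d.
Proof.
elim: ss => //= e ss IHs; rewrite cat_uniq => /and3P[_ /hasPn es us].
have notin f : f \in ss -> x \in f -> x \in e -> False.
  move=> fs xf; apply/negP/es/flattenP; by exists f.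
rewrite !inE => /predU1P[->|cs] /predU1P[->|ds] // xc xd.
- by case: (notin d).
- by case: (notin c).
- exact: IHs.
Qed.

(** Every block lies inside some run and runs are blocks, so the maximal blocks
    are among the runs.  Conversely a block that contains a run lies inside a run
    sharing a part with the first one, which is the same run because the parts are
    distinct. *)
Lemma perm_chains_runs s : gapped 2 s -> perm_eq (chains s) (runs 2 s).
Proof.
move=> gs; have us : uniq s by apply: gapped_uniq gs.
have block_runs c : is_block s c -> exists2 d, d \in runs 2 s & infix c d.
  by case/and3P; apply: infix_runs.
have runs_block_s c : c \in runs 2 s -> is_block s c.
  by move=> cs; rewrite /is_block (runs_neq0 cs) (infix_mem_runs cs) (runs_sorted cs).
have uf : uniq (flatten (runs 2 s)) by rewrite flatten_runs.
apply: uniq_perm => [||c]; first exact: chains_uniq.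
  have := @runs_neq0 2 s; elim: (runs 2 s) uf => //= c cs IHs.
  rewrite cat_uniq => /and3P[_ /hasPn ccs ucs] n0; apply/andP; split; last first.
    by apply: IHs => // d ds; apply: n0; rewrite inE ds orbT.
  apply/negP => c_cs; have := n0 c (mem_head _ _).
  case: c c_cs ccs {n0} => // x c xcs ccs _.
  have : x \in flatten cs by apply/flattenP; exists (x :: c); rewrite // mem_head.
  by move/ccs; rewrite mem_head.
apply/chainsP/idP => [[cs cmax]|cs].
  have [d ds cd] := block_runs c cs.
  by rewrite -(cmax d (runs_block_s d ds) cd).
split=> [|d ds cd]; first exact: runs_block_s.
have [e es de] := block_runs d ds.
have ce : c = e.
  have := runs_neq0 cs; case: c cs cd => // x c cs cd _.
  apply: (uniq_flatten_eq uf cs es (mem_head _ _)).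
  exact/(mem_infix de)/(mem_infix cd)/mem_head.
rewrite -ce in de; apply/esym/eqP.
by rewrite -(size_subseq_leqif (infixW cd)) eqn_leq !size_infix.
Qed.

Lemma omega_cat_block s b l : gapped 2 s -> all (leq (b + 2 * l.+1 + 1)) s ->
  omega (s ++ block 2 b l.+1) = omega s * omega_chain (block 2 b l.+1).
Proof.
move=> gs sge; rewrite /omega !(perm_big _ (perm_chains_runs _)) //.
  by rewrite runs_cat_block // big_rcons /= mulnC.
exact: gapped_cat_block.
Qed.

Lemma omega_chain_block b l : omega_chain (block 2 b l.+1) =
  if odd b then (if b == 1 then 2 * l.+1 else 4 * l.+1) else 2.
Proof.
rewrite /omega_chain /least_part last_block size_block.
have -> : all (fun x => ~~ odd x) (block 2 b l.+1) = ~~ odd b.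
  elim: l => [|l IHl]; first by rewrite /= muln0 addn0 andbT.
  rewrite -[all _ _]/(~~ odd (b + 2 * l.+1) && all (fun x => ~~ odd x) (block 2 b l.+1)).
  by rewrite IHl oddD oddM addbF andbb.
by case: odd.
Qed.

(** * Gauss's theta product *)

Section Gauss.
Local Open Scope ring_scope.
Variables (A : comNzRingType) (y : A).

(** With [(a;y)_s] the shifted factorial in base [y], this is
    [(-1)^s y^(s(n+1)) (-1;y)_s (y;y)_n / (y;y)_s], written without division. *)
Let gauss_term n s : A := (-1) ^+ s * y ^+ (s * n.+1) *
  \prod_(0 <= i < s) (1 + y ^+ i) * \prod_(s <= i < n) (1 - y ^+ i.+1).

(** The bracket [y^s (1 - y^(n+1)) - (1 + y^(n+1))], which relates the terms of
    indices n+1 and n, splits as [- (1 - y^s) - y^(n+1) (1 + y^s)], and the second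
    summand is the first one shifted by one in [s]. *)
Lemma gauss_telescope n t : (t <= n)%N ->
  \sum_(0 <= s < t) (gauss_term n.+1 s - (1 + y ^+ n.+1) * gauss_term n s) =
  (1 - y ^+ t) * gauss_term n t.
Proof.
elim: t => [|t IHt] tn; first by rewrite big_geq // expr0 subrr mul0r.
rewrite big_nat_recr //= IHt 1?ltnW // /gauss_term.
rewrite (@big_nat_recr _ _ _ t 0) //= (@big_nat_recr _ _ _ n t) 1?ltnW //=.
rewrite (big_ltn tn) (_ : t * n.+2 = t * n.+1 + t)%N; last by rewrite mulnS addnC.
rewrite mulSn !exprD (exprS (-1)); ring.
Qed.

(** A finite form of Gauss's identity in the style of Shanks: an identity of
    polynomials, provable by induction on [n], in which all terms with [s > 0]
    carry the factor [y^(n+1)] and disappear in the limit. *)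
Lemma gauss_finite n :
  (1 + 2 * \sum_(1 <= s < n.+1) (-1) ^+ s * y ^+ (s * s)) *
     \prod_(0 <= i < n) (1 + y ^+ i.+1) =
  \sum_(0 <= s < n.+1) gauss_term n s.
Proof.
elim: n => [|n IHn].
  by rewrite big_geq // big_nat1 /gauss_term !big_geq // mul0n !expr0; ring.
have prod2 : \prod_(0 <= i < n.+1) (1 + y ^+ i) =
    2 * \prod_(0 <= i < n) (1 + y ^+ i.+1).
  by rewrite big_nat_recl // expr0.
have -> : \sum_(0 <= s < n.+2) gauss_term n.+1 s = gauss_term n.+1 n.+1 +
   (\sum_(0 <= s < n.+1) (gauss_term n.+1 s - (1 + y ^+ n.+1) * gauss_term n s)
    + (1 + y ^+ n.+1) * \sum_(0 <= s < n.+1) gauss_term n s).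
  rewrite mulr_sumr -big_split /= big_nat_recr //= addrC.
  by congr (_ + _); apply: eq_bigr => s _; rewrite subrK.
rewrite -IHn [X in _ = _ + (X + _)]big_nat_recr //= gauss_telescope // /gauss_term.
rewrite prod2 [X in (_ + _ * X) * _]big_nat_recr //= [X in _ * X = _]big_nat_recr //=.
rewrite !(@big_geq _ _ _ n.+1) // !(@big_geq _ _ _ n n) // big_nat1.
move: prod2; rewrite big_nat_recr //=.
set P := \prod_(0 <= i < n) (1 + y ^+ i); set Q := \prod_(0 <= i < n) _.
set S := \sum_(1 <= s < n.+1) _ => prod2.
have En : (n.+1 * n.+2 = n.+1 * n.+1 + n.+1)%N by lia.
have En' : (n * n.+2 = n * n.+1 + n)%N by lia.
have En2 : (n.+1 * n.+1 = n * n.+1 + n.+1)%N by lia.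
rewrite En En' En2 !exprD (exprS (-1)).
apply: subr0_eq; transitivity (y ^+ n.+1 * ((-1) ^+ n * y ^+ (n * n.+1)) *
   (P * (1 + y ^+ n) - 2 * Q)); last by rewrite prod2 subrr mulr0.
ring.
Qed.

Lemma gauss_nilpotent n : y ^+ n.+1 = 0 ->
  (1 + 2 * \sum_(1 <= s < n.+1) (-1) ^+ s * y ^+ (s * s)) *
     \prod_(0 <= i < n) (1 + y ^+ i.+1) = \prod_(0 <= i < n) (1 - y ^+ i.+1).
Proof.
move=> yn; rewrite gauss_finite (@big_ltn _ _ _ 0 n.+1) // (@big_nat _ _ _ 1) big1 => [|s].
  by rewrite /gauss_term big_geq // mul0n !expr0 addr0 !mul1r.
move=> /andP[s0 _]; rewrite /gauss_term.
case: s s0 => // s _; rewrite mulSn exprD yn; ring.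
Qed.
End Gauss.

(** * Series modulo a power of q *)

Section Nilpotent.
Local Open Scope ring_scope.
Variables (A : comNzRingType) (q : A) (N : nat).
Hypothesis qN : q ^+ N = 0.

Lemma nil_exp n : (N <= n)%N -> q ^+ n = 0.
Proof. by move=> Nn; rewrite -(subnK Nn) exprD qN mulr0. Qed.

Lemma nil_gt0 : (0 < N)%N.
Proof. by case: N qN => // /eqP; rewrite expr0 oner_eq0. Qed.

(** The inverse of [1 - x] for [x] a positive power of [q]. *)
Definition geom (x : A) := \sum_(i < N) x ^+ i.

Lemma geomK j : (0 < j)%N -> (1 - q ^+ j) * geom (q ^+ j) = 1.
Proof.
move=> j0; have := subrX1 (q ^+ j) N.
rewrite -exprM (@nil_exp (j * N)) ?leq_pmull // sub0r => E.
by apply: oppr_inj; rewrite E /geom -mulNr opprB.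
Qed.

Lemma one_sub_expr_reg j (u v : A) : (0 < j)%N ->
  (1 - q ^+ j) * u = (1 - q ^+ j) * v -> u = v.
Proof.
move=> j0 /(congr1 ( *%R (geom (q ^+ j)))).
by rewrite !mulrA ![geom _ * _]mulrC geomK // !mul1r.
Qed.

(** [(-1)_k / (p)_k] in base [p = q^2]: the coefficient of [z^k] in
    [prod_i (1 + z p^i) / (1 - z p^i)]. *)
Definition ratio_m1 k : A :=
  \prod_(0 <= i < k) ((1 + q ^+ (2 * i)) * geom (q ^+ (2 * i.+1))).
(** [(-p)_k / (p)_k] in base [p = q^2]. *)
Definition ratio_mp k : A :=
  \prod_(0 <= i < k) ((1 + q ^+ (2 * i.+1)) * geom (q ^+ (2 * i.+1))).

Lemma ratio_m1_0 : ratio_m1 0 = 1. Proof. by rewrite /ratio_m1 big_geq. Qed.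

Lemma ratio_mp0 : ratio_mp 0 = 1. Proof. by rewrite /ratio_mp big_geq. Qed.

Lemma ratio_mp_prod k : ratio_mp k = (\prod_(0 <= i < k) (1 + q ^+ (2 * i.+1))) *
  \prod_(0 <= i < k) geom (q ^+ (2 * i.+1)).
Proof. exact: big_split. Qed.

Lemma ratio_m1S k :
  (1 - q ^+ (2 * k.+1)) * ratio_m1 k.+1 = (1 + q ^+ (2 * k)) * ratio_m1 k.
Proof.
rewrite /ratio_m1 big_nat_recr //= mulrCA [(1 - _) * _]mulrCA geomK //.
by rewrite mulr1 mulrC.
Qed.

Lemma ratio_mpS k :
  (1 - q ^+ (2 * k.+1)) * ratio_mp k.+1 = (1 + q ^+ (2 * k.+1)) * ratio_mp k.
Proof.
rewrite /ratio_mp big_nat_recr //= mulrCA [(1 - _) * _]mulrCA geomK //.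
by rewrite mulr1 mulrC.
Qed.

Lemma ratio_m1_mp k : (1 + q ^+ (2 * k)) * ratio_m1 k = 2 * ratio_mp k.
Proof.
elim: k => [|k IHk]; first by rewrite /ratio_m1 /ratio_mp !big_geq // muln0 expr0.
apply: (@one_sub_expr_reg (2 * k.+1)) => //.
rewrite mulrCA ratio_m1S IHk [RHS]mulrCA ratio_mpS; ring.
Qed.

Lemma sum_shift (G : nat -> A) j : (forall n, (N <= n)%N -> G n = 0) ->
  \sum_(i < N | (j <= i)%N) G i = \sum_(i < N) G (i + j)%N.
Proof.
move=> G0.
rewrite -(big_geq_mkord j N xpredT G) [LHS](big_addn 0 N j) big_mkord.
rewrite (big_ord_widen N (fun i => G (i + j)%N)) ?leq_subr //.
rewrite [RHS](bigID (fun i : 'I_N => i < N - j)%N) /= [X in _ + X]big1 ?addr0 //.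
by move=> i; rewrite -leqNgt leq_subLR addnC => /G0.
Qed.

(** For a kernel depending on the sum of the indices only, a double sum is a
    single sum against a convolution; the truncation at [N] costs nothing because
    the kernel vanishes from there on. *)
Lemma sum_conv (a b : nat -> A) (K : nat -> A) :
  (forall n, (N <= n)%N -> K n = 0) ->
  \sum_(i < N) \sum_(j < N) a i * b j * K (i + j)%N =
  \sum_(n < N) (\sum_(i < n.+1) a i * b (n - i)%N) * K n.
Proof.
move=> K0.
transitivity (\sum_(i < N) \sum_(n < N | (i <= n)%N) a i * b (n - i)%N * K n).
  apply: eq_bigr => i _.
  rewrite (sum_shift (G := fun n => a i * b (n - i)%N * K n)) => [|n /K0->].
    by apply: eq_bigr => j _; rewrite addnK addnC.
  by rewrite mulr0.
rewrite (exchange_big_dep xpredT) //=; apply: eq_bigr => n _.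
rewrite mulr_suml.
by rewrite (big_ord_widen N (fun i => a i * b (n - i)%N * K n)).
Qed.

(** Coefficients of [(1+z)/(1-z)]: the weights of even chains by length. *)
Definition twos (l : nat) : A := if l is 0 then 1 else 2.
(** Coefficients of [((1+z)/(1-z))^2]: the weights of odd chains by length. *)
Definition fours (l : nat) : A := if l is 0 then 1 else (4 * l)%:R.

Lemma twos_conv n : \sum_(i < n.+1) twos i * twos (n - i)%N = fours n.
Proof.
case: n => [|n]; first by rewrite big_ord_recl big_ord0 /= mulr1 addr0.
rewrite big_ord_recl big_ord_recr /= subnn /=.
rewrite (eq_bigr (fun=> 4)) => [|i _].
  by rewrite sumr_const card_ord -[4 *+ n]mulr_natr !natrM -natr1; ring.
rewrite /bump leq0n add1n subSS.
have : (n - i != 0)%N by have := ltn_ord i; lia.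
by case: (n - i)%N => // m _ /=; ring.
Qed.

(** The functional equation [E(z) = (1+z)/(1-z) E(pz)] of
    [E(z) = prod_i (1 + z p^i)/(1 - z p^i)], on coefficients. *)
Lemma ratio_m1_conv n :
  ratio_m1 n = \sum_(i < n.+1) twos i * (q ^+ (2 * (n - i)) * ratio_m1 (n - i)%N).
Proof.
pose f i := q ^+ (2 * i) * ratio_m1 i.
have E m : \sum_(i < m.+1) twos i * f (m - i)%N = f m + 2 * \sum_(i < m) f i.
  rewrite big_ord_recl /= mul1r subn0 mulr_sumr; congr (_ + _).
  rewrite (reindex_inj rev_ord_inj); apply: eq_bigr => i _ /=.
  by rewrite /bump add1n; congr (_ * f _); have := ltn_ord i; lia.
rewrite E; elim: n => [|n IHn].
  by rewrite big_ord0 /f muln0 expr0 mul1r mulr0 addr0.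
have := ratio_m1S n; rewrite big_ord_recr /=.
rewrite mulrBl mul1r => /(canRL (subrK _))->.
rewrite -/(f n.+1) mulrDl mul1r -/(f n) {1}IHn; ring.
Qed.

(** The functional sending [z^n] to [K n], applied to the product of the three
    generating functions with coefficients [a], [b] and [c]. *)
Definition sum3 (a b c K : nat -> A) : A :=
  \sum_(i < N) \sum_(j < N) \sum_(k < N) a i * b j * c k * K (i + j + k)%N.

Definition scaled_ratio (t : A) (k : nat) : A := t ^+ k * ratio_m1 k.
(** The contribution of the staircase 1, 3, 5, ... below [n] parts, each part
    being moreover marked by [x]. *)
Definition gauss_weight (x : A) (n : nat) : A := x ^+ n * q ^+ (n * n).

Lemma gauss_weight_big x n : (N <= n)%N -> gauss_weight x n = 0.
Proof.
move=> Nn; rewrite /gauss_weight nil_exp ?mulr0 //; apply: leq_trans Nn _.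
by case: n => // n; rewrite leq_pmulr.
Qed.

Lemma gauss_weightD x l n :
  gauss_weight x (l + n) = gauss_weight x l * gauss_weight (x * q ^+ (2 * l)) n.
Proof.
rewrite /gauss_weight exprMn -exprM exprD.
have -> : ((l + n) * (l + n) = l * l + n * n + 2 * l * n)%N by lia.
rewrite !exprD; ring.
Qed.

Lemma sum3C a b c K : sum3 a b c K = sum3 b a c K.
Proof.
rewrite /sum3 exchange_big /=; apply: eq_bigr => i _; apply: eq_bigr => j _.
by apply: eq_bigr => k _; rewrite (addnC i) (mulrC (a _)).
Qed.

Lemma sum3CA a b c K : sum3 a b c K = sum3 a c b K.
Proof.
rewrite /sum3; apply: eq_bigr => i _; rewrite exchange_big /=.
apply: eq_bigr => k _; apply: eq_bigr => j _.
by rewrite addnAC -!mulrA [b _ * _]mulrCA.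
Qed.

Lemma sum3_expand b c K : (forall n, (N <= n)%N -> K n = 0) ->
  sum3 (scaled_ratio 1) b c K =
  \sum_(l < N) twos l * sum3 (scaled_ratio (q ^+ 2)) b c (fun n => K (l + n)%N).
Proof.
move=> K0.
pose G i := \sum_(j < N) \sum_(k < N) b j * c k * K (i + j + k)%N.
have G0 n : (N <= n)%N -> G n = 0.
  move=> Nn; rewrite /G big1 // => j _; rewrite big1 // => k _.
  by rewrite K0 ?mulr0 //; lia.
transitivity (\sum_(i < N) ratio_m1 i * G i).
  rewrite /sum3; apply: eq_bigr => i _; rewrite mulr_sumr; apply: eq_bigr => j _.
  by rewrite mulr_sumr; apply: eq_bigr => k _; rewrite /scaled_ratio expr1n; ring.
under eq_bigr => i _ do rewrite ratio_m1_conv.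
rewrite -(sum_conv _ (fun i => q ^+ (2 * i) * ratio_m1 i) G0).
apply: eq_bigr => l _; rewrite /sum3 mulr_sumr; apply: eq_bigr => i _.
rewrite /G !mulr_sumr; apply: eq_bigr => j _.
rewrite !mulr_sumr; apply: eq_bigr => k _.
by rewrite /scaled_ratio -exprM -!addnA; ring.
Qed.

Lemma sum3_scale a b c x t :
  sum3 (scaled_ratio (a * t)) (scaled_ratio (b * t)) (scaled_ratio (c * t)) (gauss_weight x) =
  sum3 (scaled_ratio a) (scaled_ratio b) (scaled_ratio c) (gauss_weight (x * t)).
Proof.
apply: eq_bigr => i _; apply: eq_bigr => j _; apply: eq_bigr => k _.
rewrite /scaled_ratio /gauss_weight !exprMn !exprD; ring.
Qed.

Lemma sum3_shift a b c x l :
  sum3 a b c (fun n => gauss_weight x (l + n)) =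
  gauss_weight x l * sum3 a b c (gauss_weight (x * q ^+ (2 * l))).
Proof.
rewrite /sum3 mulr_sumr; apply: eq_bigr => i _.
rewrite mulr_sumr; apply: eq_bigr => j _.
rewrite mulr_sumr; apply: eq_bigr => k _.
rewrite gauss_weightD; ring.
Qed.

Lemma sum3_1 a b c K : (forall n, (0 < n)%N -> K n = 0) ->
  sum3 a b c K = a 0%N * b 0%N * c 0%N * K 0%N.
Proof.
move=> K0; rewrite /sum3.
have first (F : nat -> A) : (forall n, (0 < n)%N -> F n = 0) ->
    \sum_(i < N) F i = F 0%N.
  case: N nil_gt0 => // M _ F0; rewrite big_ord_recl /= big1 ?addr0 // => i _.
  exact: F0.
rewrite (first (fun i => \sum_(j < N) \sum_(k < N) a i * b j * c k * K (i + j + k)%N)).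
  rewrite (first (fun j => \sum_(k < N) a 0%N * b j * c k * K (0 + j + k)%N)).
    by rewrite (first (fun k => a 0%N * b 0%N * c k * K (0 + 0 + k)%N)) // => n n0;
      rewrite K0 ?mulr0.
  by move=> n n0; rewrite big1 // => k _; rewrite K0 ?mulr0 //; lia.
move=> n n0; rewrite big1 // => j _; rewrite big1 // => k _.
by rewrite K0 ?mulr0 //; lia.
Qed.

(** With [x = q^b], these are the weighted generating functions of the partitions
    in R with all parts greater than [b], every odd chain of length [l] having
    weight [4 * l]; [odd_start] is for least allowed part [b + 1] odd,
    [even_start] for [b + 1] even.  A factor scaled by 1 stands for the values
    v = 0, 2, 4, ... and one scaled by [q] for v = 1, 3, 5, ...; the values that
    come from odd parts have two factors. *)
Definition odd_start x :=
  sum3 (scaled_ratio 1) (scaled_ratio 1) (scaled_ratio q) (gauss_weight x).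
Definition even_start x :=
  sum3 (scaled_ratio 1) (scaled_ratio q) (scaled_ratio q) (gauss_weight x).

(** Splitting off the chain that contains the least allowed part: its length [l]
    is read from the factor [(1+z)/(1-z)] of the value v = 0. *)
Lemma even_start_rec x : even_start x =
  \sum_(l < N) twos l * gauss_weight x l * odd_start (x * q ^+ (2 * l) * q).
Proof.
rewrite /even_start sum3_expand; last exact: gauss_weight_big.
apply: eq_bigr => l _; rewrite -mulrA; congr (_ * _).
rewrite sum3_shift; congr (_ * _).
by rewrite /odd_start -(sum3_scale 1 1 q _ q) !mul1r -expr2 [LHS]sum3C [LHS]sum3CA.
Qed.

(** As for [even_start_rec], but the value v = 0 now has two factors, whose
    lengths add up. *)
Lemma odd_start_rec x : odd_start x =
  \sum_(l < N) fours l * gauss_weight x l * even_start (x * q ^+ (2 * l) * q).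
Proof.
pose K n := gauss_weight x n * even_start (x * q ^+ (2 * n) * q).
have K0 n : (N <= n)%N -> K n = 0.
  by move=> Nn; rewrite /K gauss_weight_big ?mul0r.
transitivity (\sum_(i < N) \sum_(j < N) twos i * twos j * K (i + j)%N).
  rewrite /odd_start sum3_expand; last exact: gauss_weight_big.
  apply: eq_bigr => i _; rewrite sum3C sum3_shift sum3_expand.
    rewrite !mulr_sumr; apply: eq_bigr => j _.
    rewrite sum3_shift /K gauss_weightD /even_start -(sum3_scale 1 q q _ q).
    rewrite mul1r -expr2 sum3CA [in RHS]sum3C [in RHS]sum3CA.
    rewrite -[x * _ * _]mulrA -exprD -mulnDr [in LHS]sum3CA; ring.
  exact: gauss_weight_big.
rewrite sum_conv //; apply: eq_bigr => n _; by rewrite twos_conv mulrA.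
Qed.

Lemma starts_eq1 x : x * q = 0 -> odd_start x = 1 /\ even_start x = 1.
Proof.
move=> xq; have g0 n : (0 < n)%N -> gauss_weight x n = 0.
  case: n => // n _; rewrite /gauss_weight exprS mulnS addSn exprS.
  by rewrite mulrACA xq mul0r.
by rewrite /odd_start /even_start !sum3_1 // /scaled_ratio /gauss_weight !expr0 ratio_m1_0 !mulr1.
Qed.

End Nilpotent.

(** * Evaluation of the double series *)

Section Theta.
Local Open Scope ring_scope.
Variables (A : comNzRingType) (q : A) (N : nat).
Hypothesis qN : q ^+ N = 0.
Local Notation ratio_m1 := (ratio_m1 q N).
Local Notation ratio_mp := (ratio_mp q N).

(** At [i = 0] this is the series of Lebesgue's identity. *)
Definition lebesgue_sum i : A := \sum_(k < N) q ^+ (k * k + k + 2 * i * k) * ratio_m1 k.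

(** The factors [1 - p^k] and [1 + p^k] of the recurrence of [ratio_m1] are
    produced by shifting [i]; both combinations are the same sum with its index
    shifted by one. *)
Lemma lebesgue_rec i : lebesgue_sum i =
  (1 + q ^+ (2 * i.+1)) * lebesgue_sum i.+1 + q ^+ (2 * i.+1) * lebesgue_sum i.+2.
Proof.
pose t k := q ^+ (k * k + k + 2 * i * k) * ((1 - q ^+ (2 * k)) * ratio_m1 k).
have t0 : t 0%N = 0 by rewrite /t muln0 expr0 subrr mul0r mulr0.
have tN : t N = 0.
  by rewrite /t (nil_exp qN) ?mul0r // addnAC; apply: leq_addl.
have shift : \sum_(k < N) t k = \sum_(k < N) t k.+1.
  rewrite -(big_mkord xpredT) -(big_mkord xpredT (fun k => t k.+1)).
  have : \sum_(0 <= k < N.+1) t k = t 0%N + \sum_(0 <= k < N) t k.+1.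
    exact: big_nat_recl.
  by rewrite big_nat_recr //= t0 tN addr0 add0r.
have E1 : lebesgue_sum i - lebesgue_sum i.+1 = \sum_(k < N) t k.
  rewrite -sumrB; apply: eq_bigr => k _; rewrite /t.
  have -> : (k * k + k + 2 * i.+1 * k = k * k + k + 2 * i * k + 2 * k)%N by lia.
  rewrite [q ^+ (_ + 2 * k)]exprD; ring.
have E2 : q ^+ (2 * i.+1) * (lebesgue_sum i.+1 + lebesgue_sum i.+2) =
    \sum_(k < N) t k.+1.
  rewrite mulrDr !mulr_sumr -big_split /=; apply: eq_bigr => k _.
  rewrite /t (ratio_m1S qN) !mulrA -!exprD.
  have -> : (k.+1 * k.+1 + k.+1 + 2 * i * k.+1 =
             2 * i.+1 + (k * k + k + 2 * i.+1 * k))%N by lia.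
  have -> : (2 * i.+1 + (k * k + k + 2 * i.+2 * k) =
             2 * i.+1 + (k * k + k + 2 * i.+1 * k) + 2 * k)%N by lia.
  rewrite [q ^+ (_ + 2 * k)]exprD; ring.
rewrite shift -E2 in E1.
apply: (subrI (lebesgue_sum i.+1)); apply: oppr_inj; rewrite !opprB E1; ring.
Qed.

Lemma lebesgue_big i : (N <= i)%N -> lebesgue_sum i = 1.
Proof.
move=> Ni; rewrite /lebesgue_sum.
case: N qN Ni (nil_gt0 qN) => // M qM Mi _.
rewrite big_ord_recl big1 => [|k _].
  by rewrite /= !(muln0, addn0) expr0 mul1r addr0 ratio_m1_0.
by rewrite (nil_exp qM) ?mul0r // /= /bump; lia.
Qed.

(** The coefficients on the diagonal [i - j = m] of the double series, at
    [j = k], after division by [q^(m^2)]. *)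
Definition diag m k : A := q ^+ (4 * k * k + 4 * m * k) * ratio_m1 k * ratio_m1 (m + k)
   * (1 + q ^+ (2 * (m + 2 * k))).

Definition diagsum m : A := \sum_(k < N) diag m k * lebesgue_sum (m + 2 * k).

(** Consider the combination of the recurrences [lebesgue_rec] at indices m, m+1,
    ..., with coefficients chosen so that all the coefficients of the
    [lebesgue_sum]s agree with those of the difference of the two diagonal sums.
    These coefficients turn out to be products; the right side is what remains of
    the combination after [2K] steps, and it tends to 0. *)
Lemma diag_telescope m K :
  \sum_(0 <= k < K) (diag m k * lebesgue_sum (m + 2 * k)
       - diag m.+1 k * lebesgue_sum (m.+1 + 2 * k)) =
  q ^+ (4 * K * K + 4 * m * K) *
   ((2 * q ^+ (2 * K) * ratio_mp K * ratio_mp (m + K)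
       - ratio_m1 K * ratio_m1 (m + K) * (1 + q ^+ (2 * (m + 2 * K)))) *
      lebesgue_sum (m + 2 * K)
    - q ^+ (2 * K) * ratio_m1 K * (1 - q ^+ (2 * K)) * ratio_mp (m + K) *
      lebesgue_sum (m.+1 + 2 * K)).
Proof.
elim: K => [|K IHK].
  rewrite big_geq // !muln0 !addn0 !expr0 mulrC [2 * 1]mulr1.
  rewrite ratio_m1_0 ratio_mp0; have E := ratio_m1_mp qN m.
  transitivity (((1 + q ^+ (2 * m)) * ratio_m1 m - 2 * ratio_mp m) * - lebesgue_sum m).
    by rewrite E subrr mul0r.
  ring.
rewrite big_nat_recr //= IHK.
pose p := q ^+ 2; pose k := q ^+ (2 * K); pose P := q ^+ (2 * (m + K)).
pose G := q ^+ (4 * K * K + 4 * m * K).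
(* Dividing by 1 - p k and 1 - p P here makes every other quantity a polynomial
   in k, P, e, W and the two values of lebesgue_sum. *)
pose e := geom N (q ^+ (2 * K.+1)) * ratio_m1 K.
pose W := geom N (q ^+ (2 * (m + K).+1)) * ratio_mp (m + K).
have EpK : q ^+ (2 * K.+1) = p * k by rewrite mulnS exprD.
have EpP : q ^+ (2 * (m + K).+1) = p * P by rewrite mulnS exprD.
have Ee : ratio_m1 K = (1 - p * k) * e.
  by rewrite /e mulrA -EpK (geomK qN) // mul1r.
have EW : ratio_mp (m + K) = (1 - p * P) * W.
  by rewrite /W mulrA -EpP (geomK qN) // mul1r.
have Ee1 : ratio_m1 K.+1 = (1 + k) * e.
  apply: (@one_sub_expr_reg _ _ _ qN (2 * K.+1)) => //.
  by rewrite (ratio_m1S qN) Ee EpK mulrCA.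
have Ef1 : ratio_m1 (m + K).+1 = 2 * W.
  apply: (@one_sub_expr_reg _ _ _ qN (2 * (m + K).+1)) => //.
  by rewrite (ratio_m1S qN) (ratio_m1_mp qN) EW EpP mulrCA.
have EW1 : ratio_mp (m + K).+1 = (1 + p * P) * W.
  apply: (@one_sub_expr_reg _ _ _ qN (2 * (m + K).+1)) => //.
  by rewrite (ratio_mpS qN) EW EpP mulrCA.
have Ew : 2 * ratio_mp K = (1 + k) * ((1 - p * k) * e).
  by rewrite -(ratio_m1_mp qN) Ee.
have Ew1 : 2 * ratio_mp K.+1 = (1 + p * k) * ((1 + k) * e).
  by rewrite -(ratio_m1_mp qN) EpK Ee1.
have EJ0 := lebesgue_rec (m + 2 * K); have EJ1 := lebesgue_rec (m.+1 + 2 * K).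
have [E5 E6 E7] : [/\ m + 2 * K.+1 = (m + 2 * K).+2,
  m.+1 + 2 * K.+1 = (m + 2 * K).+3 & m.+1 + 2 * K = (m + 2 * K).+1]%N by split; lia.
have [E8 E9] : (m + K.+1 = (m + K).+1 /\ m.+1 + K = (m + K).+1)%N by split; lia.
rewrite E7 in EJ1.
rewrite /diag E5 E6 E7 E8 E9.
rewrite EJ0 EJ1.
have E2 : q ^+ (2 * (m + 2 * K).+1) = p * (P * k).
  by rewrite /p /P /k -!exprD; congr (_ ^+ _); lia.
have E3 : q ^+ (2 * (m + 2 * K).+2) = p * p * (P * k).
  by rewrite /p /P /k -!exprD; congr (_ ^+ _); lia.
have E4 : q ^+ (2 * (m + 2 * K)) = P * k.
  by rewrite /P /k -!exprD; congr (_ ^+ _); lia.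
have EG : q ^+ (4 * K.+1 * K.+1 + 4 * m * K.+1) = G * k * k * P * P * p * p.
  by rewrite /G /p /P /k -!exprD; congr (_ ^+ _); lia.
have EG1 : q ^+ (4 * K * K + 4 * m.+1 * K) = G * k * k.
  by rewrite /G /p /P /k -!exprD; congr (_ ^+ _); lia.
rewrite E2 E3 E4 EG EG1 Ef1 EW1 Ee1 EW EpK -/k -/G.
rewrite (mulrAC 2 k) (mulrAC 2 (p * k)) Ew Ew1 Ee; ring.
Qed.

Lemma diagsum_succ m : diagsum m = diagsum m.+1.
Proof.
apply: subr0_eq; rewrite /diagsum -sumrB -(big_mkord xpredT (fun k =>
  diag m k * lebesgue_sum (m + 2 * k) - diag m.+1 k * lebesgue_sum (m.+1 + 2 * k))).
rewrite diag_telescope (nil_exp qN) ?mul0r //.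
by have := nil_gt0 qN; nia.
Qed.

(** The sum does not depend on [m], and for [m = N] only its first term
    survives. *)
Lemma diagsumE m : (m <= N)%N -> diagsum m = 2 * ratio_mp N.
Proof.
move=> mN; transitivity (diagsum N).
  by rewrite -(subnKC mN); elim: (N - m)%N => [|d ->]; rewrite ?addn0 // addnS diagsum_succ.
rewrite -(ratio_m1_mp qN) /diagsum.
have N0 := nil_gt0 qN.
rewrite -(big_mkord xpredT (fun k => diag N k * lebesgue_sum (N + 2 * k))).
rewrite big_ltn // (@big_nat _ _ _ 1) big1 => [|k /andP[k0 _]].
  rewrite /diag !muln0 !addn0 lebesgue_big // ratio_m1_0 expr0; ring.
rewrite /diag (nil_exp qN) ?mul0r //; nia.
Qed.

Lemma sum_diagonals (F : nat -> nat -> A) :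
  (forall i j, F i j = F j i) -> (forall i j, (N <= i + j)%N -> F i j = 0) ->
  \sum_(i < N) \sum_(j < N) F i j =
  \sum_(k < N) F k k + 2 * \sum_(1 <= m < N) \sum_(k < N) F (m + k)%N k.
Proof.
move=> FC F0.
pose D := \sum_(k < N) F k k.
pose S := \sum_(1 <= m < N) \sum_(k < N) F (m + k)%N k.
have ge_sum : \sum_(i < N) \sum_(j < N | (j <= i)%N) F i j = D + S.
  rewrite (exchange_big_dep xpredT) //=.
  rewrite (eq_bigr (fun j : 'I_N => \sum_(m < N) F (m + j)%N j)) => [|j _].
    rewrite exchange_big /= -(big_mkord xpredT (fun m => \sum_(k < N) F (m + k)%N k)).
    by rewrite big_ltn ?(nil_gt0 qN).
  by rewrite (sum_shift (G := fun i => F i j)) // => n nN; rewrite F0 //; lia.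
have gt_sum : \sum_(i < N) \sum_(j < N | (j < i)%N) F i j = S.
  apply: (addrI D); rewrite -ge_sum /D -big_split /=; apply: eq_bigr => i _.
  rewrite [RHS](bigD1 i) //=; congr (_ + _); apply: eq_bigl => j.
  by rewrite ltn_neqAle andbC.
rewrite -/D -/S.
transitivity (\sum_(i < N) \sum_(j < N | (j <= i)%N) F i j +
              \sum_(i < N) \sum_(j < N | (i < j)%N) F i j).
  rewrite -big_split /=; apply: eq_bigr => i _.
  rewrite [LHS](bigID (fun j : 'I_N => j <= i)%N) /=; congr (_ + _).
  by apply: eq_bigl => j; rewrite ltnNge.
rewrite ge_sum (exchange_big_dep xpredT) //=.
have -> : \sum_(j < N) \sum_(i < N | (i < j)%N) F i j = S.
  by rewrite -gt_sum; apply: eq_bigr => i _; apply: eq_bigr.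
ring.
Qed.

(** Summation over the third factor gives [lebesgue_sum (i + j)], and the two
    series differ by the factor [p^(i+j)] only; the rest is the sum along the
    diagonals, where [(m + 2k)^2 = m^2 + 4mk + 4k^2]. *)
Lemma starts_theta :
  odd_start q N 1 + even_start q N q = 2 * (ratio_mp N * (1 + 2 * \sum_(1 <= m < N) q ^+ (m * m))).
Proof.
pose F i j := q ^+ ((i + j) * (i + j)) * ratio_m1 i * ratio_m1 j *
  (1 + q ^+ (2 * (i + j))) * lebesgue_sum (i + j).
have -> : odd_start q N 1 + even_start q N q = \sum_(i < N) \sum_(j < N) F i j.
  have -> : even_start q N q =
      sum3 N (scaled_ratio q N (q ^+ 2)) (scaled_ratio q N (q ^+ 2))
        (scaled_ratio q N q) (gauss_weight q 1).
    have := sum3_scale q N 1 q q 1 q; rewrite /even_start !mul1r -expr2 => <-.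
    by rewrite sum3C sum3CA.
  rewrite /odd_start /sum3 -big_split /=.
  apply: eq_bigr => i _; rewrite -big_split /=; apply: eq_bigr => j _.
  rewrite -big_split /= /F /lebesgue_sum mulr_sumr; apply: eq_bigr => k _.
  rewrite /scaled_ratio /gauss_weight !expr1n -!exprM !mul1r.
  have -> : ((i + j + k) * (i + j + k) = (i + j) * (i + j) + k * k + 2 * (i + j) * k)%N by lia.
  rewrite !mulnDr !exprD; ring.
have F_diag m : (m < N)%N ->
    \sum_(k < N) F (m + k)%N k = q ^+ (m * m) * (2 * ratio_mp N).
  move=> mN; rewrite -(diagsumE (ltnW mN)) mulr_sumr; apply: eq_bigr => k _.
  rewrite /F /diag (_ : m + k + k = m + 2 * k)%N; last by lia.
  have -> : ((m + 2 * k) * (m + 2 * k) = m * m + (4 * k * k + 4 * m * k))%N by lia.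
  rewrite exprD; ring.
rewrite sum_diagonals => [|i j|i j ijN].
- have := F_diag 0%N (nil_gt0 qN); rewrite muln0 expr0 => ->.
  rewrite (@eq_big_nat _ _ _ _ _ _ (fun m => q ^+ (m * m) * (2 * ratio_mp N))).
    rewrite -mulr_suml; ring.
  by move=> m /andP[_ mN]; rewrite F_diag.
- rewrite /F [(j + i)%N]addnC; ring.
- rewrite /F (nil_exp qN) ?mul0r //; apply: leq_trans ijN _.
  by case: (i + j)%N => // n; rewrite leq_pmulr.
Qed.

Lemma big_odd_even (f : nat -> A) M : \prod_(0 <= i < 2 * M) f i =
  (\prod_(0 <= i < M) f (2 * i)%N) * \prod_(0 <= i < M) f (2 * i).+1.
Proof.
elim: M => [|M IHM]; first by rewrite !big_geq // mulr1.
rewrite mulnS !big_nat_recr //= IHM; ring.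
Qed.

(** Gauss's identity at [- q]: its even factors cancel [ratio_mp N], its odd
    factors are the product on the right. *)
Lemma theta_product :
  ratio_mp N * (1 + 2 * \sum_(1 <= m < N) q ^+ (m * m)) =
  \prod_(0 <= i < N) ((1 + q ^+ (2 * i).+1) * geom N (q ^+ (2 * i).+1)).
Proof.
have N0 := nil_gt0 qN.
(* The bound is even so that the product splits into equally many odd and even
   exponents. *)
have := @gauss_nilpotent A (- q) (2 * N).
rewrite (exprNn q) (nil_exp qN) ?mulr0; last by lia.
move=> /(_ erefl); rewrite !big_odd_even.
have -> : \sum_(1 <= s < (2 * N).+1) (-1) ^+ s * (- q) ^+ (s * s) =
          \sum_(1 <= m < N) q ^+ (m * m).
  rewrite (@big_cat_nat _ _ _ N) //=; last by lia.
  rewrite [X in _ + X]big_nat [X in _ + X]big1 ?addr0.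
    apply: eq_bigr => s _; rewrite (exprNn q) mulrA -exprD -signr_odd oddD oddM.
    by case: odd; rewrite /= expr0 mul1r.
  move=> s /andP[sN _]; rewrite (exprNn q) (nil_exp qN) ?mulr0 //; nia.
have sgn_odd i : (- q) ^+ (2 * i).+1 = - q ^+ (2 * i).+1.
  by rewrite (exprNn q) -signr_odd /= oddM /= expr1 mulN1r.
have sgn_even i : (- q) ^+ (2 * i).+2 = q ^+ (2 * i.+1).
  by rewrite mulnS (exprNn q) -signr_odd /= oddM /= expr0 mul1r.
under eq_bigr => i _ do rewrite sgn_odd.
under [\prod_(0 <= i < N) (1 + (- q) ^+ (2 * i).+2)]eq_bigr => i _ do rewrite sgn_even.
under [\prod_(0 <= i < N) (1 - (- q) ^+ (2 * i).+1)]eq_bigr => i _ do rewrite sgn_odd opprK.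
under [\prod_(0 <= i < N) (1 - (- q) ^+ (2 * i).+2)]eq_bigr => i _ do rewrite sgn_even.
have geom_prod (f : nat -> nat) : (forall i, 0 < f i)%N ->
    (\prod_(0 <= i < N) (1 - q ^+ f i)) * \prod_(0 <= i < N) geom N (q ^+ f i) = 1.
  move=> f0; rewrite -big_split /= big1 // => i _; exact: geomK.
have := geom_prod (fun i => (2 * i).+1) (fun=> isT).
have := geom_prod (fun i => 2 * i.+1)%N (fun=> isT).
rewrite ratio_mp_prod big_split /=.
set th := 1 + _; set Ev := \prod_(0 <= i < N) _; set Ev' := \prod_(0 <= i < N) _.
set Od := \prod_(0 <= i < N) _; set Od' := \prod_(0 <= i < N) _.
set Ev1 := \prod_(0 <= i < N) _; set Od1 := \prod_(0 <= i < N) _.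
move=> EvK OdK E.
transitivity (th * (Od * Ev1) * (Ev' * Od')).
  by transitivity (Ev1 * Ev' * th * (Od * Od')); [rewrite OdK mulr1 | ring].
by rewrite E; transitivity (Od1 * Od' * (Ev * Ev')); [ring | rewrite EvK mulr1].
Qed.
End Theta.

(** * Recurrences on both sides *)

Definition weight_R (b l : nat) : nat :=
  if odd b then (if b == 1 then 2 * l else 4 * l) else 2.
Definition weight_O (b l : nat) : nat := if odd b then 2 else 0.

Section GeneratingFunctions.
Local Open Scope ring_scope.
Variables (A : comNzRingType) (q : A) (N : nat).
Hypothesis qN : q ^+ N = 0.

Definition R_tail b : A :=
  if odd b then odd_start q N (q ^+ b.-1) else even_start q N (q ^+ b.-1).

(** A chain of length [l] with least part [b] has sum [(b - 1) l + l^2], which is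
    the exponent of [gauss_weight] at [x = q^(b-1)]. *)
Lemma R_tail_rec b : (0 < b)%N -> R_tail b = R_tail b.+1 +
  \sum_(1 <= l < N) (if odd b then 4 * l else 2)%:R *
     q ^+ (b * l + 2 * 'C(l, 2)) * R_tail (b + 2 * l + 1)%N.
Proof.
case: b => // b _.
have bin l : (b.+1 * l + 2 * 'C(l, 2) = b * l + l * l)%N.
  have : (2 * 'C(l, 2) + l = l * l)%N.
    by elim: l => // l IHl; rewrite binS bin1; lia.
  by lia.
have N0 := nil_gt0 qN.
have step l : q ^+ b * q ^+ (2 * l) * q = q ^+ (b + 2 * l + 1).
  by rewrite !exprD expr1.
have tail l : R_tail (b.+1 + 2 * l + 1) =
    if odd b then odd_start q N (q ^+ (b + 2 * l + 1)) else even_start q N (q ^+ (b + 2 * l + 1)).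
  by rewrite addn1 addSn /R_tail /= oddD oddM addbF addn1; case: odd.
have tail0 : R_tail b.+2 =
    if odd b then odd_start q N (q ^+ (b + 2 * 0 + 1)) else even_start q N (q ^+ (b + 2 * 0 + 1)).
  by rewrite -tail muln0 addn0 addn1.
have g0 x : gauss_weight q x 0 = 1 by rewrite /gauss_weight !expr0 mul1r.
under eq_bigr => l _ do rewrite tail bin.
rewrite tail0 /R_tail /=; case: (odd b) => /=.
- rewrite (even_start_rec qN) -(big_mkord xpredT
    (fun l => twos A l * gauss_weight q (q ^+ b) l * odd_start q N (q ^+ b * q ^+ (2 * l) * q))).
  rewrite big_ltn // /= g0 !mul1r step; congr (_ + _).
  apply: eq_big_nat => -[//|l] _; rewrite step /= /gauss_weight -exprM -exprD //.
- rewrite (odd_start_rec qN) -(big_mkord xpredT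
    (fun l => fours A l * gauss_weight q (q ^+ b) l * even_start q N (q ^+ b * q ^+ (2 * l) * q))).
  rewrite big_ltn // /= g0 !mul1r step; congr (_ + _).
  apply: eq_big_nat => -[//|l] _; rewrite step /= /gauss_weight -exprM -exprD //.
Qed.

Lemma R_tail_big b : (N <= b)%N -> R_tail b = 1.
Proof.
have N0 := nil_gt0 qN; case: b => [|b] Nb; first by move: N0 Nb; case: N.
rewrite /R_tail /=.
have [|-> ->] := @starts_eq1 A q N qN (q ^+ b); last by case: odd.
by rewrite -exprSr (nil_exp qN).
Qed.

(** Partitions in R without the part 1 are counted by [R_tail 2]; for the others
    the chain of 1 has half the weight that [R_tail 1] gives it.  Doubling avoids
    the division. *)
Lemma omega_gf k : (N <= k)%N ->
  2 * weighted_gf q 2 N omega k.+1 1 =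
  2 * (ratio_mp q N N * (1 + 2 * \sum_(1 <= m < N) q ^+ (m * m))).
Proof.
move=> Nk; have omega0 : omega [::] = 1%N.
  by rewrite /omega (perm_big _ (perm_chains_runs _)) // big_nil.
have omega_block b l s : (0 < b)%N -> gapped 2 s ->
    all (leq (b + 2 * l.+1 + 1)) s ->
    omega (s ++ block 2 b l.+1) = (omega s * weight_R b l.+1)%N.
  by move=> _ gs sge; rewrite omega_cat_block // omega_chain_block.
have gfE b : (2 <= b)%N -> weighted_gf q 2 N omega k b = R_tail b.
  move=> b2; apply: (weighted_gf_unique omega0 omega_block (c := 2) (M := N)) => //.
  - exact: R_tail_big.
  - move=> b' b'2; rewrite R_tail_rec; last by lia.
    congr (_ + _); apply: eq_bigr => l _; congr (_%:R * _ * _).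
    by rewrite /weight_R; case: eqP => // E; rewrite E in b'2.
  - lia.
rewrite (weighted_gf_rec _ _ omega_block) // gfE // -(starts_theta qN).
have := @R_tail_rec 1 isT.
have -> : even_start q N q = R_tail 2 by rewrite /R_tail /= expr1.
rewrite {1}/R_tail /= expr0 => ->.
set T := R_tail 2.
set S := \sum_(1 <= l < N) (4 * l)%:R * _ * _.
suff E : 2 * (\sum_(1 <= l < N) (weight_R 1 l)%:R *
    q ^+ (1 * l + 2 * 'C(l, 2)) * weighted_gf q 2 N omega k (1 + 2 * l + 1)%N) = S.
  by rewrite mulrDr E; ring.
rewrite mulr_sumr; apply: eq_bigr => l _; rewrite gfE; last by lia.
by rewrite /weight_R /= !natrM; ring.
Qed.

(** For gap 0 the next lower bound is [b + 1] whatever the multiplicity of [b],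
    so the recurrence is solved by a product. *)
Lemma odd_gf k : (2 * N <= k.+1)%N ->
  weighted_gf q 0 N (fun s => inO s * 2 ^ nu_d s)%N k 1 =
  \prod_(0 <= i < N) ((1 + q ^+ (2 * i).+1) * geom N (q ^+ (2 * i).+1)).
Proof.
move=> Nk.
pose f j := if odd j then (1 + q ^+ j) * geom N (q ^+ j) else 1.
have N0 := nil_gt0 qN.
have fE j : (0 < j)%N ->
    f j = 1 + \sum_(1 <= l < N) (weight_O j l)%:R * q ^+ (j * l).
  move=> j0; rewrite /f /weight_O; case: odd; last first.
    by rewrite big1 ?addr0 // => l _; rewrite mul0r.
  have E : (1 + q ^+ j) * geom N (q ^+ j) = 2 * geom N (q ^+ j) - 1.
    apply: subr0_eq.
    by transitivity (1 - (1 - q ^+ j) * geom N (q ^+ j)); [ring | rewrite geomK ?subrr].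
  rewrite E /geom -(big_mkord xpredT (fun i => (q ^+ j) ^+ i)) big_ltn // expr0.
  rewrite mulrDr mulr_sumr.
  under [in RHS]eq_bigr => l _ do rewrite exprM.
  ring.
rewrite (weighted_gf_unique (w := weight_O) (erefl : inO [::] * 2 ^ nu_d [::] = 1)%N
   odd_partition_block (c := 1) (M := 2 * N)
   (V := fun b => \prod_(b <= j < 2 * N) f j)) //.
- transitivity (\prod_(0 <= j < 2 * N) f j).
    by rewrite [RHS]big_ltn ?muln_gt0 // /f /= mul1r.
  rewrite big_odd_even big1 ?mul1r => [|i _]; last by rewrite /f oddM.
  by apply: eq_bigr => i _; rewrite /f /= oddM.
- by move=> b Nb; rewrite big_geq.
- move=> b b0.
  transitivity (f b * \prod_(b.+1 <= j < 2 * N) f j).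
    case: (ltnP b (2 * N)) => bN; first by rewrite big_ltn.
    rewrite !big_geq ?mulr1 ?fE //; last by lia.
    rewrite big_nat big1 ?addr0 // => l /andP[l0 _].
    by rewrite (nil_exp qN) ?mulr0 //; nia.
  rewrite fE // mulrDl mul1r mulr_suml; congr (_ + _).
  by apply: eq_bigr => l _; rewrite !mul0n !addn0 addn1.
Qed.

End GeneratingFunctions.

(** * Coefficient extraction *)

Section Coefficients.
Local Open Scope ring_scope.

Lemma weighted_gf_coef g N (wt : seq nat -> nat) k b n : (n < N)%N ->
  (weighted_gf ('qX : {poly %/ 'X^N : {poly int}}) g N wt k b : {poly int})`_n =
  (\sum_(s <- gapped_seqs g N k b | sumn s == n) wt s)%:R.
Proof.
move=> nN.
pose P : {poly int} := \sum_(s <- gapped_seqs g N k b) (wt s)%:R * 'X^(sumn s).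
have -> : weighted_gf ('qX : {poly %/ 'X^N : {poly int}}) g N wt k b = in_qpoly 'X^N P.
  rewrite /weighted_gf raddf_sum; apply: eq_bigr => s _.
  by rewrite [RHS]in_qpolyM (rmorph_nat (in_qpoly 'X^N)) (rmorphXn (in_qpoly 'X^N)).
have -> : (in_qpoly 'X^N P : {poly int})`_n = P`_n.
  rewrite /= mk_monic_Xn prednK; last by apply: leq_trans nN.
  by rewrite [in RHS](Pdiv.RingMonic.rdivp_eq (monicXn _ N) P) coefD coefMXn nN add0r.
rewrite coef_sum natr_sum [RHS]big_mkcond; apply: eq_bigr => s _.
rewrite -polyC_natr coefCM coefXn eq_sym; case: eqP => _.
  by rewrite mulr1.
by rewrite mulr0.
Qed.

End Coefficients.

Theorem theoremB (n : nat) :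
  \sum_(s <- partitions n | inR s) omega s
  = \sum_(s <- partitions n | inO s) 2 ^ nu_d s.
Proof.
pose N := n.+1; pose k := 2 * N.
have nN : (n < N)%N by [].
have qN : (('qX : {poly %/ ('X^N : {poly int})}) ^+ N = 0)%R.
  rewrite -(rmorphXn (in_qpoly ('X^N)%R)); apply/val_inj => /=.
  by rewrite mk_monic_Xn Pdiv.RingMonic.rmodpp ?monicXn.
have parts_gapped0 s : s \in partitions n -> gapped 0 s.
  rewrite mem_partitions => /andP[/andP[s_dec _] _].
  by apply: sub_sorted s_dec => x y; rewrite addn0.
have -> : \sum_(s <- partitions n | inO s) 2 ^ nu_d s =
           \sum_(s <- partitions n | predT s) inO s * 2 ^ nu_d s.
  rewrite big_mkcond; apply: eq_bigr => s _.
  by case: (inO s); rewrite ?mul1n.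
rewrite (@sum_partitions 2 N k.+1) ?(@sum_partitions 0 N k.+1) //; first last.
- by move=> s; rewrite /inR /gapped sorted_pairwise //; apply: gap_trans.
- by rewrite /k /N; lia.
- by move=> s /parts_gapped0->.
- by rewrite /k /N; lia.
have Nk : (N <= k) by rewrite /k /N; lia.
have Nk2 : (2 * N <= k.+2) by rewrite /k; lia.
have E := omega_gf qN Nk.
rewrite (theta_product qN) -(odd_gf qN Nk2) in E.
have {E} := congr1 (fun a : {poly %/ ('X^N : {poly int})} => (a : {poly int})`_n)%R E.
rewrite !mulr_natl !mulr2n !poly_of_qpolyD !coefD !weighted_gf_coef // -!natrD.
by move/eqP; rewrite Num.Theory.eqr_nat !addnn => /eqP/double_inj.
Qed.
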